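(* (1) For every integer $p\ge 1$, the period of the in-shuffle of a deck of $2^p$ cards is $2p$. (2) For every integer $p\ge 2$, the period of the in-shuffle of a deck of $2^p-2$ cards is $p$.
   Context: For a deck of $2n$ cards ($n\ge 1$), the in-shuffle is the permutation $f$ of $\{1,\dots,2n\}$ defined by $f(i)=i/2$ if $i$ is even, and $f(i)=(i+1)/2+n$ if $i$ is odd (after cutting the deck into cards $1,\dots,n$ and $n+1,\dots,2n$ and interleaving perfectly starting with the second packet, $f(i)$ is the number of the card at position $i$ from the bottom). The period of the shuffle is the smallest integer $r\ge 1$ such that $f^r=\mathrm{id}$ ($r$-fold composition). *)

(* Defs.v *)
From mathcomp Require Import all_boot.
From mathcomp Require Import zify.

Set Implicit Arguments.
Unset Strict Implicit.
Unset Printing Implicit Defensive.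

(* Cards and positions are numbered from 1, as in {1, ..., 2n}. *)
Definition in_deck (n i : nat) : bool := 1 <= i <= 2 * n.

(* Only the values on [in_deck n] are meaningful; [in_shuffle_deck] and
   [in_shuffle_inj] show that it restricts to a permutation of the deck. *)
Definition in_shuffle (n i : nat) : nat :=
  if odd i then (i + 1) %/ 2 + n else i %/ 2.

Lemma in_shuffle_deck (n i : nat) : in_deck n i -> in_deck n (in_shuffle n i).
Proof. by rewrite /in_deck /in_shuffle; case: ifP => ?; lia. Qed.

Lemma in_shuffle_inj (n : nat) : {in in_deck n &, injective (in_shuffle n)}.
Proof.
move=> i j; rewrite !unfold_in /in_deck /in_shuffle.
by case: ifP => ?; case: ifP => ?; lia.
Qed.

Definition in_shuffle_restores (n r : nat) : Prop :=
  forall i : nat, in_deck n i -> iter r (in_shuffle n) i = i.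

Definition in_shuffle_period (n r : nat) : Prop :=
  [/\ 1 <= r, in_shuffle_restores n r
    & forall s : nat, 1 <= s -> in_shuffle_restores n s -> r <= s].

(* Main.v *)
Require Import Defs.
From mathcomp Require Import all_boot.
From mathcomp Require Import zify.

(** Modulo [2n + 1] the in-shuffle is division by 2, so [r] in-shuffles restore
    the deck iff [2 ^ r = 1] modulo [2n + 1]: the period is the multiplicative
    order of 2 modulo [2n + 1], here [2 ^ p + 1] or [2 ^ p - 1]. *)

Lemma double_in_shuffle n i : 2 * in_shuffle n i = i %[mod (2 * n).+1].
Proof.
rewrite /in_shuffle; case: ifP => oi; last by congr (_ %% _); lia.
(* For odd [i] the double is [i + 1 + 2 * n], which exceeds [i] by exactly the modulus. *)
by rewrite -(modnDr i); congr (_ %% _); lia.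
Qed.

Lemma expn_iter_in_shuffle n r i :
  2 ^ r * iter r (in_shuffle n) i = i %[mod (2 * n).+1].
Proof.
elim: r => [|r IHr]; first by rewrite mul1n.
by rewrite iterS expnSr -mulnA -modnMmr double_in_shuffle modnMmr.
Qed.

Lemma iter_in_shuffle_deck n r i :
  in_deck n i -> in_deck n (iter r (in_shuffle n) i).
Proof. by move=> di; elim: r => //= r; apply: in_shuffle_deck. Qed.

(** Following card 1 alone already yields the congruence. Conversely, the congruence makes card [i]
    and its image congruent, and both lie in [1..2n], where residues modulo [2n + 1] are
    distinct. *)
Lemma in_shuffle_restoresP n r : 0 < n ->
  in_shuffle_restores n r <-> 2 ^ r = 1 %[mod (2 * n).+1].
Proof.
move=> n_gt0; split=> [restores | eq1 i di].
  have := expn_iter_in_shuffle n r 1.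
  by rewrite restores ?muln1 // /in_deck; lia.
have := expn_iter_in_shuffle n r i.
rewrite -modnMml eq1 modnMml mul1n.
have := iter_in_shuffle_deck n r i di; move: di; rewrite /in_deck => di dj.
by rewrite !modn_small //; lia.
Qed.

Lemma expn2_neq1_mod m s : 0 < s -> 2 ^ s < m -> 2 ^ s <> 1 %[mod m].
Proof.
move=> s_gt0 ltm; have lt1 : 1 < 2 ^ s by rewrite -(expn0 2) ltn_exp2l.
by rewrite !modn_small //; lia.
Qed.

Lemma expn2_order_succ p s : 0 < s -> 2 ^ s = 1 %[mod (2 ^ p).+1] -> 2 * p <= s.
Proof.
move=> s_gt0 eq1; rewrite leqNgt; apply/negP => lt_s_2p.
case: (leqP s p) => [le_sp | lt_ps].
  by apply: expn2_neq1_mod eq1; rewrite // ltnS leq_exp2l.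
(* As [2 ^ p = -1], [2 ^ s = 1] would give [1 + 2 ^ (s - p) = 0]. *)
have lt_exp : 2 ^ (s - p) < 2 ^ p by rewrite ltn_exp2l //; lia.
have: 1 + 2 ^ (s - p) = 0 %[mod (2 ^ p).+1].
  rewrite -modnDml -eq1 modnDml mod0n; apply/eqP.
  (* With 1 replaced by [2 ^ s], the sum factors as [2 ^ (s - p) * (2 ^ p + 1)]. *)
  by rewrite -{1}(subnK (ltnW lt_ps)) expnD -mulnSr; apply: dvdn_mull.
by rewrite mod0n modn_small //; lia.
Qed.

Theorem mainTheorem3 :
  (forall p n : nat, 1 <= p -> 2 * n = 2 ^ p -> in_shuffle_period n (2 * p)) /\
  (forall p n : nat, 2 <= p -> 2 * n = 2 ^ p - 2 -> in_shuffle_period n p).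
Proof.
split=> p n p_ge def_n.
  have n_gt0 : 0 < n by have := expn_gt0 2 p; lia.
  split=> [||s s_gt0 /(in_shuffle_restoresP _ _ n_gt0)]; first by lia.
    apply/in_shuffle_restoresP => //; rewrite def_n.
    have -> : 2 ^ (2 * p) = (2 ^ p - 1) * (2 ^ p).+1 + 1.
      by rewrite mulnC expnM; have := expn_gt0 2 p; nia.
    by rewrite modnMDl.
  by rewrite def_n; apply: expn2_order_succ.
(* This makes the truncated subtraction [2 ^ p - 2] exact and nonzero. *)
have exp_ge4 : 2 ^ 2 <= 2 ^ p by rewrite leq_exp2l.
have n_gt0 : 0 < n by lia.
split=> [||s s_gt0 /(in_shuffle_restoresP _ _ n_gt0) eq1]; first by lia.
  apply/in_shuffle_restoresP => //.
  have -> : 2 ^ p = (2 * n).+1 + 1 by lia.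
  by rewrite modnDl.
rewrite leqNgt; apply/negP => lt_sp; apply: expn2_neq1_mod eq1 => //.
(* The modulus is now [2 ^ p - 1], so [2 ^ s < 2 ^ p] is too weak; [2 ^ s] is at most half of
   [2 ^ p], which is below the modulus as [2 ^ p >= 4]. *)
have : 2 ^ s.+1 <= 2 ^ p by rewrite leq_exp2l.
by rewrite expnS; lia.
Qed.
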